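(* Let $K$ be a field, let $G$ be a finite simple graph with vertex set $V(G)=\{x_1,\ldots,x_n\}$, and let $R=K[x_1,\ldots,x_n]$. Suppose there exists an edge $e=\{u,v\}\in E(G)$ such that $\mathcal{N}_G(u)\subseteq \mathcal{N}_G[v]$ or $\mathcal{N}_G(v)\subseteq\mathcal{N}_G[u]$. Then $$\mathrm{v}(J(G))\leq \mathrm{bight}(I(G))-1\leq \mathrm{reg}(R/J(G)).$$
   Context: For a vertex $w$ of $G$, $\mathcal{N}_G(w)=\{u\in V(G) : \{u,w\}\in E(G)\}$ and $\mathcal{N}_G[w]=\mathcal{N}_G(w)\cup\{w\}$. $R=K[x_1,\ldots,x_n]=\bigoplus_{d\ge 0}R_d$ has the standard grading; the vertices of $G$ are identified with the variables of $R$. The edge ideal of $G$ is $I(G)=\langle x_ix_j : \{x_i,x_j\}\in E(G)\rangle\subseteq R$. $\mathrm{bight}(I(G))$ (big height) is the maximum height of an associated prime of $I(G)$; it equals the maximum cardinality of a minimal vertex cover of $G$. A vertex cover of $G$ is a set $C\subseteq V(G)$ meeting every edge; it is minimal if it is minimal under inclusion. For $C\subseteq V(G)$ put $X_C=\prod_{x_i\in C}x_i$. The cover ideal of $G$ is $J(G)=\langle X_C : C \text{ a minimal vertex cover of } G\rangle=\bigcap_{\{x_i,x_j\}\in E(G)}\langle x_i,x_j\rangle$. For a proper graded ideal $I\subseteq R$, the $\mathrm{v}$-number is $\mathrm{v}(I)=\min\{d\ge 0 : \text{there exist } f\in R_d \text{ and } \mathfrak p\in \mathrm{Ass}(I) \text{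 with } I:f=\mathfrak p\}$, where $\mathrm{Ass}(I)$ is the set of associated primes of $I$ (i.e. of $R/I$). $\mathrm{reg}(R/I)=\max\{j-i : \beta_{i,j}(R/I)\ne 0\}$ is the Castelnuovo-Mumford regularity, where $\beta_{i,j}(R/I)$ are the graded Betti numbers of $R/I$ over $R$. *)

(* Defs.v *)
From HB Require Import structures.
From mathcomp Require Import all_boot all_order all_algebra.
From mathcomp Require Import mpoly.
From Stdlib Require Import ClassicalEpsilon.

Set Implicit Arguments.
Unset Strict Implicit.
Unset Printing Implicit Defensive.

Import GRing.Theory.
Local Open Scope ring_scope.

(* Minimum and maximum of a set of naturals, obtained by classical
   description.  The values are meaningful only when the minimum (resp. the
   maximum) exists. *)
Definition is_nat_min (P : nat -> Prop) (m : nat) : Prop :=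
  P m /\ forall k, P k -> (m <= k)%N.
Definition is_nat_max (P : nat -> Prop) (m : nat) : Prop :=
  P m /\ forall k, P k -> (k <= m)%N.
Definition nat_min (P : nat -> Prop) : nat := epsilon (inhabits 0%N) (is_nat_min P).
Definition nat_max (P : nat -> Prop) : nat := epsilon (inhabits 0%N) (is_nat_max P).

Record sgraph (n : nat) := SGraph {
  adj :> rel 'I_n;
  adj_sym : ssrbool.symmetric adj;
  adj_irrefl : irreflexive adj
}.

Section Graph.
Context {n : nat} (G : sgraph n).

Definition open_nbhd (w : 'I_n) : {set 'I_n} := [set u | G u w].
Definition closed_nbhd (w : 'I_n) : {set 'I_n} := w |: open_nbhd w.

Definition vertex_cover (C : {set 'I_n}) : bool :=
  [forall x, forall y, G x y ==> (x \in C) || (y \in C)].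
Definition min_vertex_cover (C : {set 'I_n}) : bool := minset vertex_cover C.

End Graph.

Section Ideals.
Context {K : fieldType} {n : nat}.
Notation R := {mpoly K[n]}.

(* Arbitrary ideals are Prop-valued predicates; prime ideals use the boolean
   predicates of ring_quotient, where [idealr_closed] includes properness. *)
Definition ideal_gen (S : R -> Prop) (f : R) : Prop :=
  exists s : seq (R * R),
    (forall q, q \in s -> S q.2) /\ f = \sum_(q <- s) q.1 * q.2.

Definition is_prime (p : {pred R}) : Prop :=
  idealr_closed p /\ prime_idealr_closed p.

(* I : f = p *)
Definition colon_eq (I : R -> Prop) (f : R) (p : {pred R}) : Prop :=
  forall g : R, g \in p <-> I (g * f).

(* p is the annihilator of the class of some f in R/I. *)
Definition is_assoc (I : R -> Prop) (p : {pred R}) : Prop :=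
  is_prime p /\ exists f : R, colon_eq I f p.

Definition strict_subpred (p q : {pred R}) : Prop :=
  {subset p <= q} /\ exists2 f : R, f \in q & f \notin p.

Definition prime_chain_below (p : {pred R}) (h : nat) : Prop :=
  exists c : nat -> {pred R},
    [/\ forall i, (i <= h)%N -> is_prime (c i),
        forall i, (i < h)%N -> strict_subpred (c i) (c i.+1)
      & c h =i p].

Definition height (p : {pred R}) : nat := nat_max (prime_chain_below p).

Definition bight (I : R -> Prop) : nat :=
  nat_max (fun h => exists2 p : {pred R}, is_assoc I p & height p = h).

Definition v_number (I : R -> Prop) : nat :=
  nat_min (fun d => exists (f : R) (p : {pred R}),
             [/\ f \is d.-homog, is_assoc I p & colon_eq I f p]).

(* Finitely generated graded free modules and homogeneous maps of degree 0:
   F_i is the direct sum of the R(- fdeg i k) for k < frank i, its elements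
   are row vectors, and [fdiff i] is the map v |-> v *m fdiff i from F_(i+1)
   to F_i. *)
Record free_seq := FreeSeq {
  frank : nat -> nat;
  fdeg : forall i, 'I_(frank i) -> nat;
  fdiff : forall i, 'M[R]_(frank i.+1, frank i)
}.
Arguments fdeg F {i} : rename.
Arguments fdiff F i : rename.

(* ... -> F_1 -> F_0 -> R/I -> 0 is a minimal graded free resolution of R/I,
   for I a proper graded ideal; F_0 = R is encoded by its single generator,
   in degree 0. *)
Record is_min_resolution (I : R -> Prop) (F : free_seq) : Prop := {
  res_rank0 : frank F 0 = 1%N;
  res_deg0 : forall k : 'I_(frank F 0), fdeg F k = 0%N;
  res_graded : forall i (k : 'I_(frank F i.+1)) (l : 'I_(frank F i)) m,
    m \in msupp (fdiff F i k l) -> (mdeg m + fdeg F l = fdeg F k)%N;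
  res_exact0 : forall v : 'rV[R]_(frank F 0),
    (forall k, I (v 0 k)) <-> exists w, v = w *m fdiff F 0;
  res_exactS : forall i (v : 'rV[R]_(frank F i.+1)),
    v *m fdiff F i = 0 <-> exists w, v = w *m fdiff F i.+1;
  res_minimal : forall i k l, (fdiff F i k l)@_0%MM = 0
}.

(* beta_(i,j)(R/I), read off a minimal graded free resolution F *)
Definition graded_betti (F : free_seq) (i j : nat) : nat :=
  #|[set k : 'I_(frank F i) | fdeg F k == j]|.

(* reg(R/I) = r.  Minimal graded free resolutions are unique up to
   isomorphism, so at most one r qualifies; one exists by Hilbert's syzygy
   theorem. *)
Definition is_regularity_quot (I : R -> Prop) (r : int) : Prop :=
  exists F : free_seq,
    [/\ is_min_resolution I F,
        exists i j, graded_betti F i j <> 0%N /\ j%:Z - i%:Z = r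
      & forall i j, graded_betti F i j <> 0%N -> j%:Z - i%:Z <= r].

End Ideals.

Section GraphIdeals.
Variables (K : fieldType) (n : nat) (G : sgraph n).
Notation R := {mpoly K[n]}.

Definition edge_ideal : R -> Prop :=
  ideal_gen (fun g : R => exists i j : 'I_n, G i j /\ g = 'X_i * 'X_j).

Definition cover_ideal : R -> Prop :=
  ideal_gen (fun g : R => exists C : {set 'I_n},
               min_vertex_cover G C /\ g = \prod_(i in C) 'X_i).

End GraphIdeals.

Arguments edge_ideal K {n} G _.
Arguments cover_ideal K {n} G _.

(* Main.v *)
Require Import Defs.
From HB Require Import structures.
From mathcomp Require Import all_boot all_order all_algebra.
From mathcomp Require Import mpoly.
From Stdlib Require Import Classical ClassicalEpsilon.

(* Write p_A for the prime generated by the variables in A.  The edge ideal is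
   the intersection of the p_C over the minimal vertex covers C, and the cover
   ideal J is the intersection of the p_e over the edges e; the associated
   primes of such an intersection are among the intersected primes.  As p_C has
   height #|C|, bight is the maximal size of a minimal vertex cover.

   If N(u) is contained in N[v], take a minimal vertex cover C avoiding v.  The
   edge uv is the only one not covered by C - u, so the product f of the
   variables in C - u satisfies J : f = p_uv, which bounds the v-number.
   For the regularity, X_C is a minimal generator of J for each minimal vertex
   cover C, so that beta_(1, #|C|) is nonzero.

   The upper bound on the height of p_C measures the dimension of a prime P by
   the sets of variables S with P meeting K[S] only in 0. *)

Set Implicit Arguments.
Unset Strict Implicit.
Unset Printing Implicit Defensive.
Import GRing.Theory.
Local Open Scope ring_scope.

(** * Minimal elements and closure properties of ideals *)

Lemma ex_min_nat (T : Type) (size : T -> nat) (S : T -> Prop) (x : T) :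
  S x -> exists2 y, S y & forall z, S z -> (size y <= size z)%N.
Proof.
have [k] := ubnP (size x); elim: k x => // k IHk x le_xk Sx.
have [[z [Sz lt_zx]]|noz] := classic (exists z, S z /\ (size z < size x)%N).
  by apply: (IHk z) => //; apply: leq_trans lt_zx _.
by exists x => // z Sz; rewrite leqNgt; apply/negP => lt_zx; apply: noz; exists z.
Qed.

Section IdealClosed.
Variables (A : nzRingType) (p : {pred A}).
Hypothesis idp : idealr_closed p.

Lemma idealr_closed0 : 0 \in p. Proof. by case: idp. Qed.

Lemma idealr_closedMl a x : x \in p -> a * x \in p.
Proof. by case: idp => p0 _ pD px; rewrite -[_ * _]addr0 pD. Qed.

Lemma idealr_closedD x y : x \in p -> y \in p -> x + y \in p.
Proof. by case: idp => _ _ pD px py; rewrite -[x]mul1r pD. Qed.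

Lemma idealr_closedB x y : x \in p -> y \in p -> x - y \in p.
Proof. by case: idp => _ _ pD px py; rewrite addrC -mulN1r pD. Qed.

Lemma idealr_closed_sum I (r : seq I) (P : pred I) (F : I -> A) :
  (forall i, P i -> F i \in p) -> \sum_(i <- r | P i) F i \in p.
Proof.
move=> pF; elim/big_ind: _ => //; [exact: idealr_closed0|exact: idealr_closedD].
Qed.

End IdealClosed.

Lemma prime_idealr_closedX (A : nzRingType) (p : {pred A}) (x : A) k :
  idealr_closed p -> prime_idealr_closed p -> x ^+ k \in p -> x \in p.
Proof.
move=> [_ p1 _] pp; elim: k => [|k IHk]; first by rewrite expr0 (negPf p1).
by rewrite exprS => /pp /orP[].
Qed.

Lemma idealr_closed_preim (A B : nzRingType) (f : {rmorphism A -> B}) (p : {pred B}) :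
  idealr_closed p -> idealr_closed [pred x | f x \in p].
Proof.
case=> p0 p1 pD; split; rewrite ?inE ?rmorph0 ?rmorph1 // => a x y.
by rewrite !inE rmorphD rmorphM => px py; apply: pD.
Qed.

Lemma prime_idealr_closed_preim (A B : nzRingType) (f : {rmorphism A -> B})
  (p : {pred B}) : prime_idealr_closed p -> prime_idealr_closed [pred x | f x \in p].
Proof. by move=> pp x y; rewrite !inE rmorphM => /pp. Qed.

(** * Comparable primes in a univariate polynomial ring *)

Section FiberOfPolynomialRing.
Variables (A : idomainType) (P Q : {pred {poly A}}).
Hypotheses (idP : idealr_closed P) (prP : prime_idealr_closed P).
Hypotheses (idQ : idealr_closed Q) (PQ : {subset P <= Q}).

Let size_drop_lead (h : {poly A}) : h != 0 ->
  (size (h - lead_coef h *: 'X^((size h).-1))%R < size h)%N.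
Proof.
move=> h0; have h_gt0 : (0 < size h)%N by rewrite size_poly_gt0.
rewrite -[ltnRHS](prednK h_gt0) ltnS; apply/leq_sizeP => j le_j.
rewrite coefB coefZ coefXn; have [->|neq_j] := eqVneq j (size h).-1.
  by rewrite mulr1 subrr.
rewrite mulr0 subr0 nth_default //.
by rewrite -(prednK h_gt0) ltn_neqAle eq_sym neq_j.
Qed.

(* Two primes in a chain with the same trace on A coincide as soon as the
   smaller one is not extended from A: reduce a minimal-degree element g of
   Q outside P modulo a minimal-degree h in P not extended from A, or h modulo
   g. *)
Lemma poly_prime_trace (g h : {poly A}) (i : nat) :
    g \in Q -> g \notin P -> h \in P -> (h`_i)%:P \notin P ->
  exists2 a : A, a%:P \in Q & a%:P \notin P.
Proof.
move=> Qg Pg Ph Phi.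
have [{Qg Pg}g [Qg Pg] ming] := ex_min_nat (fun q : {poly A} => size q)
  (S := fun q => q \in Q /\ q \notin P) (conj Qg Pg).
have [{i Ph Phi}h [Ph [i Phi]] minh] := ex_min_nat (fun q : {poly A} => size q)
  (S := fun q => q \in P /\ exists i, (q`_i)%:P \notin P)
  (conj Ph (ex_intro _ i Phi)).
have P0 := idealr_closed0 idP.
have extP q : q \in P -> (size q < size h)%N -> forall j, (q`_j)%:P \in P.
  move=> Pq lt_qh j; apply/negPn/negP => Pqj.
  by have := minh q (conj Pq (ex_intro _ j Pqj)); rewrite leqNgt lt_qh.
have smallQ q : q \in Q -> (size q < size g)%N -> q \in P.
  move=> Qq lt_qg; apply/negPn/negP => Pq.
  by have := ming q (conj Qq Pq); rewrite leqNgt lt_qg.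
have g0 : g != 0 by apply: contraNneq Pg => ->.
have h0 : h != 0 by apply: contraNneq Phi => ->; rewrite coef0 polyC0.
have PCX (a : A) k : a%:P \in P -> a *: 'X^k \in P.
  by move=> Pa; rewrite -mul_polyC mulrC idealr_closedMl.
(* Otherwise dropping the leading term of [g] leaves a shorter element of [Q], which is in [P] by
   minimality, and [g] would be in [P]. *)
have Plg : (lead_coef g)%:P \notin P.
  apply: contra Pg => /(PCX _ (size g).-1) Plg.
  rewrite -(subrK (lead_coef g *: 'X^((size g).-1)) g) idealr_closedD //.
  apply: smallQ; last exact: size_drop_lead.
  by apply: idealr_closedB => //; apply: PQ.
have Plh : (lead_coef h)%:P \notin P.
  apply/negP => Plh; have Pth := PCX _ (size h).-1 Plh.
  have /(_ i) := extP _ (idealr_closedB idP Ph Pth) (size_drop_lead h0).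
  move: Phi; rewrite coefB coefZ coefXn; have [->|_] := eqVneq i (size h).-1.
    by rewrite -lead_coefE Plh.
  by rewrite mulr0 subr0 => /negPf->.
(* Pseudo-division scales the dividend by a power of the divisor's leading coefficient; primality
   keeps that power outside [P]. *)
have lead_pow (q r : {poly A}) : (lead_coef q)%:P \notin P ->
    (lead_coef q ^+ scalp r q)%:P \notin P.
  by apply: contra; rewrite polyC_exp => /(prime_idealr_closedX idP prP).
have [le_g1|gt_g1] := leqP (size g) 1.
  by have Eg := size1_polyC le_g1; exists g`_0; rewrite -Eg.
have [le_gh|lt_hg] := leqP (size g) (size h).
  have Eh := Pdiv.Idomain.divp_eq h g.
  have lt_r : (size (h %% g)%R < size g)%N by rewrite Pdiv.Idomain.ltn_modp.
  have Er : h %% g = lead_coef g ^+ scalp h g *: h - h %/ g * g.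
    by rewrite Eh addrC addKr.
  have Pch : lead_coef g ^+ scalp h g *: h \in P.
    by rewrite -mul_polyC idealr_closedMl.
  have Pr : h %% g \in P.
    apply: smallQ => //; rewrite Er idealr_closedB //; first exact: PQ.
    exact: idealr_closedMl.
  have Pq : h %/ g \in P.
    have: h %/ g * g \in P.
      have -> : h %/ g * g = lead_coef g ^+ scalp h g *: h - h %% g.
        by rewrite Eh addrK.
      exact: idealr_closedB.
    by move/prP; rewrite (negPf Pg) orbF.
  have lt_q : (size (h %/ g)%R < size h)%N.
    rewrite Pdiv.Idomain.size_divp // ltn_subrL size_poly_gt0 h0 andbT.
    by rewrite -ltnS prednK ?size_poly_gt0.
  have Ei : (lead_coef g ^+ scalp h g)%:P * (h`_i)%:P \in P.
    rewrite -polyCM -coefZ Eh coefD polyCD idealr_closedD //; last first.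
      by apply: extP => //; apply: leq_trans lt_r le_gh.
    rewrite coefM rmorph_sum /=; apply: idealr_closed_sum => // j _.
    by rewrite polyCM mulrC idealr_closedMl // extP.
  by move/prP: Ei; rewrite (negPf Phi) (negPf (lead_pow _ _ Plg)).
(* If [h] is the divisor, the remainder is a shorter element of [Q], hence in [P]; then a scalar
   multiple of [g] is in [P], against primality. *)
have Eg := Pdiv.Idomain.divp_eq g h.
have Er : g %% h = lead_coef h ^+ scalp g h *: g - g %/ h * h.
  by rewrite Eg addrC addKr.
have lt_r : (size (g %% h)%R < size g)%N.
  by apply: ltn_trans lt_hg; rewrite Pdiv.Idomain.ltn_modp.
have Pr : g %% h \in P.
  apply: smallQ => //; rewrite Er idealr_closedB //.
    by rewrite -mul_polyC idealr_closedMl.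
  by apply: idealr_closedMl => //; apply: PQ.
have: (lead_coef h ^+ scalp g h)%:P * g \in P.
  by rewrite mul_polyC Eg idealr_closedD // idealr_closedMl.
by move/prP; rewrite (negPf Pg) (negPf (lead_pow _ _ Plh)).
Qed.

End FiberOfPolynomialRing.

(** * Primes generated by variables, and their chains *)

Section VariablePrimes.
Variables (K : fieldType) (n : nat).
Local Notation R := {mpoly K[n]}.
Implicit Types (A S T : {set 'I_n}) (m : 'X_{1..n}) (f g : R).

Lemma mpoly_rmorph_ext (B : comNzRingType) (f g : {rmorphism R -> B}) :
  (forall c, f c%:MP = g c%:MP) -> (forall i, f 'X_i = g 'X_i) -> f =1 g.
Proof.
move=> eqC eqX; elim/mpolyind => [|c m p _ _ IHp]; first by rewrite !rmorph0.
rewrite !rmorphD IHp -!mul_mpolyC !rmorphM eqC; congr (_ * _ + _).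
rewrite mpolyXE_id !rmorph_prod; apply: eq_bigr => i _.
by rewrite !rmorphXn eqX.
Qed.

Definition mvars m : {set 'I_n} := [set i | m i != 0%N].

Lemma mvarsD m1 m2 : mvars (m1 + m2)%MM = mvars m1 :|: mvars m2.
Proof. by apply/setP=> i; rewrite !inE mnmDE addn_eq0 negb_and. Qed.

(** This retraction of R onto K[S] represents the subring as an image inside R, so that no separate
    polynomial ring is introduced. *)
Definition keep_vars S : R -> R :=
  mmap (@mpolyC n K) (fun i => if i \in S then 'X_i else 0).

HB.instance Definition _ S := GRing.RMorphism.copy (keep_vars S)
  (mmap (@mpolyC n K) (fun i => if i \in S then 'X_i else 0)).

Lemma keep_varsC S c : keep_vars S c%:MP = c%:MP.
Proof. by rewrite /keep_vars mmapC. Qed.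

Lemma keep_varsXU S i : keep_vars S 'X_i = if i \in S then 'X_i else 0.
Proof. by rewrite /keep_vars mmapX mmap1U. Qed.

Lemma keep_varsZ S c f : keep_vars S (c *: f) = c *: keep_vars S f.
Proof. by rewrite -!mul_mpolyC rmorphM /= keep_varsC. Qed.

Lemma keep_varsX S m :
  keep_vars S 'X_[m] = if mvars m \subset S then 'X_[m] else 0.
Proof.
rewrite mpolyXE_id rmorph_prod; case: ifPn => [/subsetP mS|/subsetPn[i]].
  apply: eq_bigr => i _; rewrite rmorphXn /= keep_varsXU.
  by have [->|mi] := eqVneq (m i) 0%N; rewrite ?expr0 // mS ?inE.
rewrite inE => mi /negPf Si; rewrite (bigD1 i) //= rmorphXn /= keep_varsXU Si.
by rewrite expr0n (negPf mi) mul0r.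
Qed.

Lemma mcoeff_keep_vars S f m :
  (keep_vars S f)@_m = if mvars m \subset S then f@_m else 0.
Proof.
elim/mpolyind: f => [|c m' p _ _ IHp]; first by rewrite rmorph0 mcoeff0 if_same.
rewrite rmorphD /= !mcoeffD IHp keep_varsZ !mcoeffZ keep_varsX.
have [->|neq] := eqVneq m' m; first by case: ifP => _; rewrite ?mcoeff0 ?mulr0 ?addr0.
rewrite mcoeffX (negPf neq) mulr0 add0r; case: (mvars m' \subset S).
  by rewrite mcoeffX (negPf neq) mulr0 add0r.
by rewrite mcoeff0 mulr0 add0r.
Qed.

Lemma keep_varsT f : keep_vars setT f = f.
Proof. by apply/mpolyP=> m; rewrite mcoeff_keep_vars subsetT. Qed.

Lemma keep_vars_sub S T f : S \subset T ->
  keep_vars T (keep_vars S f) = keep_vars S f.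
Proof.
move=> sST; apply/mpolyP=> m; rewrite !mcoeff_keep_vars.
by case: ifPn => //; case: ifP => // sm /negP[]; apply: subset_trans sST.
Qed.

(* The ideal generated by the variables in A, as a kernel so that primality is
   immediate. *)
Definition var_prime A : {pred R} := [pred f | keep_vars (~: A) f == 0].

(** Killing the variables of [A] only erases monomials, so nothing can cancel and membership is
    decided monomial by monomial. *)
Lemma var_primeP A f :
  reflect (forall m, m \in msupp f -> ~~ [disjoint mvars m & A]) (f \in var_prime A).
Proof.
rewrite inE; apply: (iffP eqP) => [f0 m|Af].
  have := congr1 (mcoeff m) f0; rewrite mcoeff_keep_vars mcoeff0 -disjoints_subset.
  by case: ifP => // _ f0m; rewrite mcoeff_msupp f0m eqxx.
apply/mpolyP=> m; rewrite mcoeff_keep_vars mcoeff0 -disjoints_subset.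
case: ifP => // dis; apply/eqP; rewrite mcoeff_eq0.
by apply/negP=> /Af; rewrite dis.
Qed.

Lemma var_primeX A m : ('X_[m] \in var_prime A) = ~~ [disjoint mvars m & A].
Proof.
apply/var_primeP/idP => [|Am m']; first by apply; rewrite msuppX inE.
by rewrite msuppX inE => /eqP->.
Qed.

Lemma var_prime_prime A : is_prime (var_prime A).
Proof.
split; first split; rewrite ?inE ?rmorph0 ?rmorph1 ?oner_eq0 //.
  by move=> a x y; rewrite !inE rmorphD rmorphM /= => /eqP-> /eqP->; rewrite mulr0 addr0.
by move=> x y; rewrite !inE rmorphM mulf_eq0.
Qed.

Lemma var_primeMl A f g : g \in var_prime A -> f * g \in var_prime A.
Proof. by apply: idealr_closedMl; case: (var_prime_prime A). Qed.

Lemma var_prime_sub A (B : {set 'I_n}) : A \subset B -> {subset var_prime A <= var_prime B}.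
Proof.
move=> sAB f /var_primeP Af; apply/var_primeP => m /Af.
by apply: contra; apply: disjointWr.
Qed.

(* P meets K[S] only in 0, K[S] being the image of [keep_vars S]. *)
Definition free_vars (P : {pred R}) S :=
  forall f, keep_vars S f \in P -> keep_vars S f = 0.

Section Extend.
Variables (j : 'I_n).

(** [split_var] makes x_j the univariate indeterminate; [join_var S] restricts the coefficients to
    K[S] and puts x_j back. Thus R[X] maps onto K[S][x_j]. *)
Let split_var : R -> {poly R} :=
  mmap (polyC \o @mpolyC n K) (fun i => if i == j then 'X else ('X_i : R)%:P).

Let join_var S : {poly R} -> R :=
  horner_eval ('X_j : R) \o map_poly (keep_vars S).

Let join_split S f : j \notin S ->
  join_var S (split_var f) = keep_vars (j |: S) f.
Proof.
move=> jS.
pose F : {rmorphism R -> R} := join_var S \o split_var.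
apply: (mpoly_rmorph_ext (f := F)) => [c|i] /=; rewrite /join_var /split_var /=.
  by rewrite mmapC /= map_polyC /= /horner_eval hornerC !keep_varsC.
rewrite mmapX mmap1U !keep_varsXU !inE; have [->|_] := eqVneq i j.
  by rewrite map_polyX /horner_eval hornerX.
by rewrite map_polyC /horner_eval hornerC /= keep_varsXU.
Qed.

(** Eliminates x_j from an element of [Q] outside [P], by applying [poly_prime_trace] to the
    preimages of [P] and [Q] under [join_var T]. *)
Lemma prime_drop_var (P Q : {pred R}) S T f g :
    is_prime P -> is_prime Q -> {subset P <= Q} -> free_vars Q S ->
    S \subset T -> j \notin T ->
    keep_vars (j |: S) f \in P -> keep_vars (j |: S) f != 0 ->
    keep_vars (j |: T) g \in Q -> keep_vars (j |: T) g \notin P ->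
  exists g', keep_vars T g' \in Q /\ keep_vars T g' \notin P.
Proof.
move=> [idP prP] [idQ prQ] PQ freeQ sST jT Pf f0 Qg Pg.
have jS : j \notin S by apply: contra jT => /(subsetP sST).
(* The coefficients of [h] lie in K[S], where [Q] has only 0; a nonzero one is therefore outside
   [Q], and so outside [P]. *)
pose h := map_poly (keep_vars S) (split_var f).
have Eh : join_var T h = keep_vars (j |: S) f.
  rewrite -join_split // /join_var /= -map_poly_comp; congr (horner_eval _ _).
  by apply: eq_map_poly => x; rewrite /= keep_vars_sub.
have [i hi0] : exists i, h`_i != 0.
  exists (size h).-1; rewrite -lead_coefE lead_coef_eq0.
  by apply: contraNneq f0 => h0; rewrite -Eh h0 /join_var /= rmorph0 /horner_eval horner0.
pose PT := [pred q | join_var T q \in P]; pose QT := [pred q | join_var T q \in Q].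
have Econst (a : R) : join_var T a%:P = keep_vars T a.
  by rewrite /join_var /= map_polyC /horner_eval hornerC.
have [||||||||a Qa Pa] := @poly_prime_trace _ PT QT _ _ _ _ (split_var g) h i.
- exact: idealr_closed_preim.
- exact: prime_idealr_closed_preim.
- exact: idealr_closed_preim.
- by move=> q; apply: PQ.
- by rewrite inE join_split.
- by rewrite inE join_split.
- by rewrite inE Eh.
- rewrite inE Econst coef_map /= keep_vars_sub //.
  by apply: contra hi0 => /PQ/freeQ /= Ei; rewrite coef_map /= Ei.
by exists a; rewrite !inE !Econst in Qa Pa.
Qed.

End Extend.

(* Dimension drops along strict inclusions: if no variable could be added to
   S, all of them would be algebraic over K[S] modulo P, and eliminating them
   one by one would bring an element of Q outside P into K[S]. *)
Lemma free_vars_extend (P Q : {pred R}) S :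
    is_prime P -> is_prime Q -> strict_subpred P Q -> free_vars Q S ->
  exists2 j, j \notin S & free_vars P (j |: S).
Proof.
move=> prP prQ [PQ [g Qg Pg]] freeQ; apply: NNPP => noj.
have P0 : 0 \in P by case: prP => /idealr_closed0.
have relP j : j \notin S ->
    exists2 f, keep_vars (j |: S) f \in P & keep_vars (j |: S) f != 0.
  move=> jS; apply: NNPP => nof; apply: noj; exists j => // f Pf.
  by apply/eqP/negPn/negP => f0; apply: nof; exists f.
(* Variables leave [T] one at a time, starting from all of them with [g] itself. At [T = S] the
   element is 0 by freeness, yet 0 is in [P]. *)
suff drop k T : #|~: T| = k -> S \subset T ->
    exists g', keep_vars T g' \in Q /\ keep_vars T g' \notin P.
  have [g' [/freeQ->]] := drop _ S erefl (subxx S).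
  by rewrite P0.
elim: k T => [|k IHk] T cardT sST.
  exists g; suff -> : T = setT by rewrite keep_varsT.
  by rewrite -[T]setCK (cards0_eq cardT) setC0.
have /set0Pn[j jT] : ~: T != set0 by rewrite -card_gt0 cardT.
rewrite inE in jT.
have [||g' [Qg' Pg']] := IHk (j |: T).
- apply/eqP; rewrite -eqSS -cardT setCU setIC -setDE.
  by rewrite (cardsD1 j (~: T)) inE jT.
- exact: subset_trans sST (subsetUr _ _).
have [f Pf f0] := relP j (contra (subsetP sST j) jT).
exact: (prime_drop_var prP prQ PQ freeQ sST jT Pf f0 Qg' Pg').
Qed.

(** Each step down the chain adds a free variable to [S], and there are only [n] variables. *)
Lemma height_bound (p : {pred R}) S h :
  free_vars p S -> prime_chain_below p h -> (#|S| + h <= n)%N.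
Proof.
move=> freeS [c [prc strc ch]].
suff [T cardT _] : exists2 T : {set 'I_n}, #|T| = (#|S| + h)%N & free_vars (c 0%N) T.
  by rewrite -cardT -[leqRHS]card_ord max_card.
have {}freeS : free_vars (c h) S by move=> f; rewrite ch; apply: freeS.
elim: h => [|h IHh] in S prc strc freeS {ch} *; first by exists S; rewrite ?addn0.
have [j jS freej] := free_vars_extend (prc h (leqnSn h)) (prc _ (leqnn _))
  (strc h (ltnSn h)) freeS.
have [||T cardT freeT] := IHh _ _ _ freej.
- by move=> i le_ih; apply: prc; apply: leqW.
- by move=> i lt_ih; apply: strc; apply: leqW.
by exists T; rewrite // cardT cardsU1 jS addSnnS.
Qed.

Lemma var_prime_free A : free_vars (var_prime A) (~: A).
Proof. by move=> f; rewrite inE keep_vars_sub // => /eqP. Qed.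

(** The variables of [A] are added one by one in the order of [enum A]. *)
Lemma var_prime_chain (p : {pred R}) A : p =i var_prime A -> prime_chain_below p #|A|.
Proof.
move=> pA; pose B k := [set i in take k (enum A)].
have subB k l : (k <= l)%N -> B k \subset B l.
  move=> le_kl; apply/subsetP => i; rewrite !inE -(subnKC le_kl) takeD mem_cat.
  by move=> ->.
exists (fun k => var_prime (B k)); split=> [i _|i lt_i|f].
- exact: var_prime_prime.
- split; first exact/var_prime_sub/subB.
  have lt_i' : (i < size (enum A))%N by rewrite -cardE.
  have /card_gt0P[x _] : (0 < #|A|)%N by apply: leq_ltn_trans (leq0n i) lt_i.
  pose y := nth x (enum A) i.
  have supp_y : mvars U_(y)%MM = [set y].
    by apply/setP=> z; rewrite !inE mnm1E [z == y]eq_sym; case: (y == z).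
  (* As [enum A] has no repetition, ['X_y] lies in the prime of [B i.+1] but not in that of
     [B i]. *)
  have: uniq (take i (enum A) ++ drop i (enum A)) by rewrite cat_take_drop enum_uniq.
  rewrite (drop_nth x) // cat_uniq => /and3P[_ /hasPn/(_ y)].
  rewrite mem_head => /(_ isT) /= take_y _.
  exists 'X_y; rewrite var_primeX supp_y disjoints1 inE.
    by rewrite negbK (take_nth x) // mem_rcons mem_head.
  by rewrite negbK.
- rewrite pA; congr (f \in var_prime _).
  by apply/setP=> i; rewrite inE cardE take_size mem_enum.
Qed.

End VariablePrimes.
Arguments var_prime K {n} A _.

(** * Extremal values obtained by classical description *)

Lemma nat_min_le (P : nat -> Prop) d : P d -> (nat_min P <= d)%N.
Proof.
move=> Pd; have [m Pm minm] := ex_min_nat id Pd.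
have: is_nat_min P (nat_min P).
  by apply: (epsilon_spec (inhabits 0%N)); exists m; split.
by case=> _; apply.
Qed.

Lemma nat_maxP (P : nat -> Prop) b x :
  P x -> (forall k, P k -> (k <= b)%N) -> is_nat_max P (nat_max P).
Proof.
move=> Px leb; apply: (epsilon_spec (inhabits 0%N)).
(* The truncated difference from [b] reverses the order below [b], so its minimum gives the
   maximum. *)
have [m Pm minm] := ex_min_nat (fun k => b - k)%N Px.
exists m; split=> // k Pk; have := leq_sub2l b (minm k Pk).
by rewrite !subKn // leb.
Qed.

(** * Squarefree monomial ideals and their associated primes *)

Section SquarefreeIdeals.
Variables (K : fieldType) (n : nat).
Local Notation R := {mpoly K[n]}.
Implicit Types (A C D S : {set 'I_n}) (F : {set 'I_n} -> Prop) (m : 'X_{1..n}).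
Implicit Types (f g : R) (p : {pred R}) (I : R -> Prop).

(** The chain adding the variables of [A] bounds the height below; the free variables outside [A]
    bound it above through [height_bound]. *)
Lemma height_var_prime p A : p =i var_prime K A -> height p = #|A|.
Proof.
move=> pA; have chainA := var_prime_chain pA.
have leA h : prime_chain_below p h -> (h <= #|A|)%N.
  have freep : free_vars p (~: A) by move=> f; rewrite pA; apply: var_prime_free.
  move/(height_bound freep); rewrite -[leqRHS]card_ord -(cardsC A) addnC.
  by rewrite leq_add2r.
have [chain_ht max_ht] := nat_maxP chainA leA.
by apply/eqP; rewrite eqn_leq leA //= max_ht.
Qed.

Lemma mpolyX_set D : 'X_[mesym1 D] = \prod_(i in D) 'X_i :> R.
Proof.
rewrite mpolyXE_id [RHS]big_mkcond; apply: eq_bigr => i _; rewrite mnmE.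
by case: (i \in D).
Qed.

Lemma mvars_mesym1 D : mvars (mesym1 D) = D.
Proof. by apply/setP=> i; rewrite inE mnmE; case: (i \in D). Qed.

Lemma mesym1_le D m : (mesym1 D <= m)%MM = (D \subset mvars m).
Proof.
apply/mnm_lepP/subsetP => [leD i Di|sD i].
  by rewrite inE -lt0n; apply: leq_trans (leD i); rewrite mnmE Di.
by rewrite mnmE; have [/sD|//] := boolP (i \in D); rewrite inE -lt0n.
Qed.

Lemma ideal_gen_gen (X : R -> Prop) f : X f -> ideal_gen X f.
Proof.
move=> Xf; exists [:: (1, f)]; split=> [q|]; first by rewrite inE => /eqP->.
by rewrite big_seq1 mul1r.
Qed.

Lemma ideal_gen0 (X : R -> Prop) : ideal_gen X 0.
Proof. by exists [::]; rewrite big_nil. Qed.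

Lemma ideal_genD (X : R -> Prop) f g :
  ideal_gen X f -> ideal_gen X g -> ideal_gen X (f + g).
Proof.
move=> [s [Xs ->]] [t [Xt ->]]; exists (s ++ t); rewrite big_cat; split=> // q.
by rewrite mem_cat => /orP[/Xs|/Xt].
Qed.

Lemma ideal_genM (X : R -> Prop) a f : ideal_gen X f -> ideal_gen X (a * f).
Proof.
move=> [s [Xs ->]]; exists [seq (a * q.1, q.2) | q <- s]; split=> [q|].
  by case/mapP=> q' /Xs Xq' ->.
by rewrite big_map mulr_sumr; apply: eq_bigr => q _; rewrite mulrA.
Qed.

Definition sqfree_gens F g : Prop := exists D, F D /\ g = \prod_(i in D) 'X_i.

Lemma sqfree_idealP F f : ideal_gen (sqfree_gens F) f <->
  forall m, m \in msupp f -> exists2 D, F D & D \subset mvars m.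
Proof.
split=> [[s [Fs ->]] m|supp_f].
  rewrite mcoeff_msupp raddf_sum /= => sm0.
  have [q qs qm] : exists2 q, q \in s & (q.1 * q.2)@_m != 0.
    apply: NNPP => noq; case/eqP: sm0; rewrite big_seq big1 // => q qs.
    by apply/eqP/negPn/negP => qm; apply: noq; exists q.
  have [D [FD Eq]] := Fs q qs; exists D => //.
  move: qm; rewrite mcoeff_eq0 negbK Eq -mpolyX_set (perm_mem (msuppMX _ _)).
  by case/mapP=> m' _ ->; rewrite mvarsD mvars_mesym1 subsetUl.
rewrite [f]mpolyE big_seq.
elim/big_ind: _ => [||m /supp_f[D FD sDm]]; [exact: ideal_gen0|exact: ideal_genD|].
rewrite -mul_mpolyC; apply: ideal_genM; rewrite -mesym1_le in sDm.
rewrite -(submK sDm) mpolyXD; apply/ideal_genM/ideal_gen_gen.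
by exists D; rewrite mpolyX_set.
Qed.

(** Both memberships are tested on the supports [W] of the monomials of [f], so the equality is the
    combinatorial duality [dual]. *)
Lemma sqfree_ideal_cap F F' f :
    (forall W : {set 'I_n}, (exists2 D, F D & D \subset W) <->
               (forall A, F' A -> ~~ [disjoint W & A])) ->
  ideal_gen (sqfree_gens F) f <-> (forall A, F' A -> f \in var_prime K A).
Proof.
move=> dual; rewrite sqfree_idealP; split=> [Ff A F'A|Ff m fm].
  by apply/var_primeP => m /Ff/dual; apply.
by apply/dual => A /Ff/var_primeP; apply.
Qed.

Section Primary.
Variables (I : R -> Prop) (F : {set 'I_n} -> Prop).
Hypothesis capI : forall f, I f <-> (forall A, F A -> f \in var_prime K A).

(** I : f is the intersection of the components not containing [f]. A prime equal to none of them
    would miss an element of each, and the product of these elements lies in the intersection. *)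
Lemma assoc_var_prime p : is_assoc I p -> exists A, F A /\ p =i var_prime K A.
Proof.
move=> [[idp prp] [f colon]].
have pE g : g \in p <-> forall A, F A -> f \notin var_prime K A -> g \in var_prime K A.
  rewrite colon capI; split=> [gf A FA /negPf fA|gA A FA].
    by have [_ prA] := var_prime_prime K A; move/prA: (gf A FA); rewrite fA orbF.
  have [fA|/(gA A FA) g_A] := boolP (f \in var_prime K A).
    exact: var_primeMl.
  by rewrite mulrC var_primeMl.
apply: NNPP => noA.
have avoid A : exists2 g, g \notin p &
    (F A -> f \notin var_prime K A -> g \in var_prime K A).
  apply: NNPP => nog; apply: noA; exists A.
  have [FA fA] : F A /\ f \notin var_prime K A.
    apply: NNPP => nFf; apply: nog; exists 1; first by case: idp.
    by move=> FA fA; case: nFf.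
  split=> // g; apply/idP/idP => [/pE|gA]; first by apply.
  by apply/negPn/negP => gp; apply: nog; exists g.
have [g gp gA] : exists2 g, g \notin p & forall A, A \in enum {set 'I_n} ->
    F A -> f \notin var_prime K A -> g \in var_prime K A.
  elim: (enum _) => [|A s [g gp gs]]; first by exists 1 => //; case: idp.
  have [g' g'p g'A] := avoid A; exists (g' * g).
    by apply/negP=> /prp; rewrite (negPf gp) (negPf g'p).
  move=> B; rewrite inE => /predU1P[->|Bs] FB fB.
    by rewrite mulrC var_primeMl ?g'A.
  by rewrite var_primeMl ?gs.
by case/negP: gp; apply/pE => A; apply: gA; rewrite mem_enum.
Qed.

(** The monomial lies in every component except that of [A], and there primality cancels it. *)
Lemma colon_var_prime A D : F A -> [disjoint D & A] ->
    (forall B, F B -> B <> A -> ~~ [disjoint D & B]) ->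
  colon_eq I 'X_[mesym1 D] (var_prime K A).
Proof.
move=> FA disDA meetD g; rewrite capI; split=> [gA B FB|gB].
  have [->|neqBA] := eqVneq B A; first by rewrite mulrC var_primeMl.
  have DB : 'X_[mesym1 D] \in var_prime K B.
    by rewrite var_primeX mvars_mesym1; apply/meetD/eqP.
  exact: var_primeMl.
have [_ prA] := var_prime_prime K A.
by move/prA: (gB A FA); rewrite var_primeX mvars_mesym1 disDA orbF.
Qed.

Lemma var_prime_assoc A D : F A -> [disjoint D & A] ->
    (forall B, F B -> B <> A -> ~~ [disjoint D & B]) ->
  is_assoc I (var_prime K A).
Proof.
move=> FA disDA meetD; split; first exact: var_prime_prime.
by exists 'X_[mesym1 D]; apply: colon_var_prime.
Qed.

End Primary.
End SquarefreeIdeals.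

(** * Edge ideals and cover ideals *)

Section GraphIdealsTheory.
Variables (K : fieldType) (n : nat) (G : sgraph n).
Local Notation R := {mpoly K[n]}.
Implicit Types (C W A : {set 'I_n}).

Definition is_edge A : Prop := exists i j, G i j /\ A = [set i; j].

Lemma vertex_coverP W :
  vertex_cover G W <-> forall A, is_edge A -> ~~ [disjoint W & A].
Proof.
split=> [/forallP covW _ [i [j [Gij ->]]]|covW].
  have /forallP/(_ j)/implyP/(_ Gij) := covW i.
  by case/orP=> Wx; apply/pred0Pn; [exists i|exists j]; rewrite /= Wx !inE eqxx ?orbT.
apply/'forall_forallP => i j; apply/implyP => Gij.
have /pred0Pn[k /=] : ~~ [disjoint W & [set i; j]] by apply: covW; exists i, j.
by rewrite !inE => /andP[Wk /orP[]/eqP <-]; rewrite Wk ?orbT.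
Qed.

(** If [W] contains no edge, its complement is a vertex cover and contains a minimal one, which is
    disjoint from [W]. *)
Lemma edge_dual W : (exists2 D, is_edge D & D \subset W) <->
  (forall C, min_vertex_cover G C -> ~~ [disjoint W & C]).
Proof.
split=> [[D edgeD sDW] C /minsetp/vertex_coverP/(_ D edgeD)|meetW].
  by apply: contra; rewrite disjoint_sym => dis; apply: disjointWr dis.
apply: NNPP => noD.
have: vertex_cover G (~: W).
  apply/vertex_coverP => A edgeA; rewrite disjoint_sym disjoints_subset setCK.
  by apply/negP=> sAW; apply: noD; exists A.
case/minset_exists=> C minC; rewrite subsetC -disjoints_subset => dis.
by have := meetW C minC; rewrite dis.
Qed.

Lemma cover_dual W : (exists2 D, min_vertex_cover G D & D \subset W) <->
  (forall A, is_edge A -> ~~ [disjoint W & A]).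
Proof.
rewrite -vertex_coverP; split=> [[D /minsetp covD sDW]|/minset_exists[D minD sDW]].
  apply/vertex_coverP => A /(proj1 (vertex_coverP D) covD).
  by apply: contra; apply: disjointWl.
by exists D.
Qed.

Lemma edge_ideal_cap (f : R) : edge_ideal K G f <->
  (forall C, min_vertex_cover G C -> f \in var_prime K C).
Proof.
rewrite -(sqfree_ideal_cap _ edge_dual).
have pairE i j : G i j -> 'X_i * 'X_j = \prod_(k in [set i; j]) 'X_k :> R.
  move=> Gij; rewrite big_setU1 ?big_set1 // inE.
  by apply: contraTneq Gij => ->; rewrite (adj_irrefl G).
split=> -[s [gens ->]]; exists s; split=> // q /gens.
  by move=> [i [j [Gij ->]]]; exists [set i; j]; rewrite pairE //; split=> //; exists i, j.
by move=> [_ [[i [j [Gij ->]]] ->]]; exists i, j; rewrite pairE.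
Qed.

Lemma cover_ideal_cap (f : R) : cover_ideal K G f <->
  (forall A, is_edge A -> f \in var_prime K A).
Proof. by rewrite -(sqfree_ideal_cap _ cover_dual). Qed.

(** The product of the variables outside [C] is the witness: a minimal cover that it misses is
    contained in [C], hence equal to [C]. *)
Lemma min_vertex_cover_assoc C :
  min_vertex_cover G C -> is_assoc (edge_ideal K G) (var_prime K C).
Proof.
move=> minC; apply: (var_prime_assoc edge_ideal_cap (D := ~: C)) => //.
  by rewrite disjoints_subset.
move=> B minB neqBC; rewrite disjoint_sym disjoints_subset setCK; apply/negP => sBC.
by apply: neqBC; apply: (minsetinf minC (minsetp minB)).
Qed.

Lemma bight_edge_ideal : is_nat_max
  (fun h => exists2 C, min_vertex_cover G C & #|C| = h) (bight (edge_ideal K G)).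
Proof.
have [C0 minC0] : {C | min_vertex_cover G C}.
  by apply: ex_minset; exists setT; apply/'forall_forallP => i j; rewrite !inE implybT.
have htE h : (exists2 p : {pred R}, is_assoc (edge_ideal K G) p & height p = h) <->
    exists2 C, min_vertex_cover G C & #|C| = h.
  split=> [[p /(assoc_var_prime edge_ideal_cap)[C [minC pC]] <-]|[C minC <-]].
    by exists C; rewrite // (height_var_prime pC).
  exists (var_prime K C); first exact: min_vertex_cover_assoc.
  exact: height_var_prime.
have [|h /htE[C _ <-]|bC maxb] := @nat_maxP
  (fun h => exists2 p : {pred R}, is_assoc (edge_ideal K G) p & height p = h) n #|C0|.
- by apply/htE; exists C0.
- by rewrite -[leqRHS]card_ord max_card.
by split; [exact/htE|move=> k /htE/maxb].
Qed.

(* The product of the variables in C :\ u lies in the prime of every edge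
   except {u, v}: an edge from u to a vertex outside C ends in N[v], hence in
   v, as C contains N(v). *)
Lemma v_number_cover_ideal u v C :
    G u v -> open_nbhd G u \subset closed_nbhd G v ->
    min_vertex_cover G C -> v \notin C ->
  (v_number (cover_ideal K G) <= #|C|.-1)%N.
Proof.
move=> Guv sNuv minC Cv; have covC := proj1 (vertex_coverP C) (minsetp minC).
have covE x y : G x y -> (x \in C) || (y \in C).
  by move=> Gxy; have /minsetp/'forall_forallP/(_ x y)/implyP/(_ Gxy) := minC.
have Cu : u \in C by have := covE u v Guv; rewrite (negPf Cv) orbF.
have edge_uv : is_edge [set u; v] by exists u, v.
have disC : [disjoint C :\ u & [set u; v]].
  rewrite disjoints_subset; apply/subsetP => x; rewrite !inE negb_or.
  by case/andP=> -> /=; apply: contraTneq => ->.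
have meetC B : is_edge B -> B <> [set u; v] -> ~~ [disjoint C :\ u & B].
  have aux y : G u y -> y != v -> y \in C :\ u.
    move=> Guy neq_yv; rewrite !inE; apply/andP; split.
      by apply: contraTneq Guy => ->; rewrite (adj_irrefl G).
    have: y \in closed_nbhd G v.
      by apply: (subsetP sNuv); rewrite inE (adj_sym G).
    by rewrite !inE (negPf neq_yv) => /covE; rewrite (negPf Cv) orbF.
  move=> [x [y [Gxy ->]]] neqB.
  have [Exu|neq_xu] := eqVneq x u.
    apply/pred0Pn; exists y; rewrite /= !inE eqxx orbT andbT -in_setD1 aux //.
      by rewrite -Exu.
    by apply/eqP => Eyv; apply: neqB; rewrite Exu Eyv.
  have [Eyu|neq_yu] := eqVneq y u.
    apply/pred0Pn; exists x; rewrite /= !inE eqxx andbT -in_setD1 aux //.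
      by rewrite -Eyu (adj_sym G).
    by apply/eqP => Exv; apply: neqB; rewrite Exv Eyu setUC.
  have /orP[Cx|Cy] := covE x y Gxy; apply/pred0Pn.
    by exists x; rewrite /= !inE neq_xu Cx eqxx.
  by exists y; rewrite /= !inE neq_yu Cy eqxx orbT.
apply: nat_min_le; exists 'X_[mesym1 (C :\ u)], (var_prime K [set u; v]); split.
- by rewrite dhomogX /= mdeg_mesym1 (cardsD1 u C) Cu /= eqxx.
- exact: (var_prime_assoc cover_ideal_cap edge_uv disC meetC).
- exact: (colon_var_prime cover_ideal_cap edge_uv disC meetC).
Qed.

(** There is no loop at [v], so the other vertices already form a cover. *)
Lemma min_vertex_cover_avoiding v : exists2 C, min_vertex_cover G C & v \notin C.
Proof.
have: vertex_cover G [set~ v].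
  apply/'forall_forallP => i j; apply/implyP => Gij; rewrite !inE -negb_and.
  by apply: contraTN Gij => /andP[/eqP-> /eqP->]; rewrite (adj_irrefl G).
case/minset_exists=> C minC /subsetP sC; exists C => //.
by apply/negP => /sC; rewrite !inE eqxx.
Qed.

(** Write X_C as a combination of the generators in the first differential. Some generator has a
    monomial dividing X_C; its support contains a minimal cover inside [C], so that monomial is X_C
    and the grading gives the degree. *)
Lemma resolution_min_cover (F : free_seq (K := K) (n := n)) C :
    is_min_resolution (cover_ideal K G) F -> min_vertex_cover G C ->
  graded_betti F 1 #|C| <> 0%N.
Proof.
move=> resF minC; apply/eqP; rewrite -lt0n; apply/card_gt0P.
have rk0 : (0 < frank F 0)%N by rewrite (res_rank0 resF).
pose o : 'I_(frank F 0) := Ordinal rk0.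
have genJ D : min_vertex_cover G D -> cover_ideal K G 'X_[mesym1 D].
  by move=> minD; apply: ideal_gen_gen; exists D; rewrite mpolyX_set.
have [w Ew] : exists w, \row_(l < frank F 0) 'X_[mesym1 C] = w *m fdiff F 0.
  by apply/(res_exact0 resF) => l; rewrite mxE; apply: genJ.
have rowJ k : cover_ideal K G (fdiff F 0 k o).
  have := proj2 (res_exact0 resF (row k (fdiff F 0))).
  by move/(_ (ex_intro _ (delta_mx 0 k) (rowE _ _)) o); rewrite mxE.
have [k wk] : exists k, mesym1 C \in msupp (w 0 k * fdiff F 0 k o).
  apply: NNPP => nok; have := congr1 (fun M : 'rV[R]_(frank F 0) => (M 0 o)@_(mesym1 C)) Ew.
  rewrite !mxE mcoeffX eqxx raddf_sum big1 /= => [/eqP|k _]; first by rewrite oner_eq0.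
  by apply/eqP; rewrite mcoeff_eq0; apply/negP => wk; apply: nok; exists k.
have /allpairsP[[m1 m2] /= [m1w m2d EC]] := msuppM_le wk.
have [D minD sDm2] := proj1 (sqfree_idealP _ _) (rowJ k) m2 m2d.
have EDC : D = C.
  apply: (minsetinf minC (minsetp minD)); apply: subset_trans sDm2 _.
  by rewrite -(mvars_mesym1 C) EC mvarsD subsetUr.
have leC : (mesym1 C <= m2)%MM by rewrite mesym1_le -EDC.
(* The degree of generator [k] is that of [m2], which divides X_C and is divisible by it. *)
exists k; rewrite inE -(res_graded resF m2d) (res_deg0 resF) addn0 eqn_leq.
rewrite -(mdeg_mesym1 C) {1}EC mdegD leq_addl /=.
by rewrite -(submK leC) mdegD leq_addl.
Qed.

End GraphIdealsTheory.

Theorem proposition3p1 (K : fieldType) (n : nat) (G : sgraph n)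
  (hG : exists u v : 'I_n, G u v /\
     ((open_nbhd G u \subset closed_nbhd G v) \/
      (open_nbhd G v \subset closed_nbhd G u))) :
  (v_number (cover_ideal K G))%:Z <= (bight (edge_ideal K G))%:Z - 1 /\
  (forall r : int, is_regularity_quot (cover_ideal K G) r ->
     (bight (edge_ideal K G))%:Z - 1 <= r).
Proof.
have [[C minC cardC] maxC] := bight_edge_ideal K G.
split; last first.
  move=> r [F [resF _ max_r]]; rewrite -cardC.
  (* The Betti number sits in homological degree 1, which accounts for the -1. *)
  exact: max_r (resolution_min_cover resF minC).
have [u [v [Guv sNuv]]] : exists u v : 'I_n, G u v /\
    open_nbhd G u \subset closed_nbhd G v.
  have [u [v [Guv [sN|sN]]]] := hG; first by exists u, v.
  by exists v, u; rewrite (adj_sym G).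
have [D minD Dv] := min_vertex_cover_avoiding G v.
have le_v := v_number_cover_ideal K Guv sNuv minD Dv.
(* Needed because the predecessor in [le_v] is truncated at 0; [D] contains [u], as it covers the
   edge without [v]. *)
have D_gt0 : (0 < #|D|)%N.
  apply/card_gt0P; exists u.
  have /minsetp/'forall_forallP/(_ u v)/implyP/(_ Guv) := minD.
  by rewrite (negPf Dv) orbF.
rewrite Num.Theory.lerBrDr -PoszD lez_nat addn1.
by apply: leq_ltn_trans le_v _; rewrite prednK //; apply: maxC; exists D.
Qed.
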